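(* Assume that $\Omega\neq\emptyset$ and that $\Omega$ is bounded (in $L^\infty([0,T];\mathbb{R}^n)$). Then (CLP) has an optimal solution.
   Context: Setting: $T>0$, and $A:[0,T]\to\mathbb{R}^{m\times n}$, $b:[0,T]\to\mathbb{R}^m$, $c:[0,T]\to\mathbb{R}^n$ have measurable, essentially bounded entries. Problem (CLP): minimize $F(z)=\int_0^T c(t)^\top z(t)\,dt$ over the feasible set $\Omega=\{z\in L^\infty([0,T];\mathbb{R}^n): A(t)z(t)\le b(t)\text{ a.e. in }[0,T]\}$ (inequalities componentwise). $\bar z\in\Omega$ is an optimal solution if $F(\bar z)\le F(z)$ for all $z\in\Omega$. *)

(* Defs.v *)
(* MathComp-Analysis.

   Functions on [0, T] are represented by total functions on R whose values
   outside [0, T] are irrelevant, and elements of L^infty by representatives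
   (no quotient by almost-everywhere equality).  Measurability and "a.e." are
   those of Lebesgue: the measure is the completed Lebesgue measure, defined on
   the Lebesgue-measurable sets, and not its restriction to the Borel sets.  *)
From HB Require Import structures.
From mathcomp Require Import all_boot all_order all_algebra.
From mathcomp Require Import all_classical all_reals all_analysis.
Set Implicit Arguments.
Unset Strict Implicit.
Unset Printing Implicit Defensive.
Import Order.TTheory GRing.Theory Num.Theory.
Import numFieldNormedType.Exports.
Local Open Scope classical_set_scope.
Local Open Scope ring_scope.

Local Notation mu := completed_lebesgue_measure.

(* L^infty([0, T]; R): [f \_ `[0, T]] is the extension of f by 0, so that its
   measurability on the line is measurability of f on [0, T]. *)
Definition Linfty (R : realType) (T : R) (f : R -> R) : Prop :=
  (f \_ `[0, T]) \in Lfun (@mu R) +oo%E.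

Definition Linfty_mx (R : realType) (T : R) (m n : nat)
    (A : R -> 'M[R]_(m, n)) : Prop :=
  forall i j, Linfty T (fun t => A t i j).

(* The norm on R^n is the library's one (the maximum norm). *)
Definition Linfty_norm (R : realType) (T : R) (n : nat) (z : R -> 'cV[R]_n)
    : \bar R :=
  'N[@mu R]_+oo [EFin \o ((fun t => `|z t|) \_ `[0, T])].

Definition Linfty_bounded (R : realType) (T : R) (n : nat)
    (X : set (R -> 'cV[R]_n)) : Prop :=
  exists M : R, forall z, X z -> (Linfty_norm T z <= M%:E)%E.

Definition feasible (R : realType) (T : R) (m n : nat)
    (A : R -> 'M[R]_(m, n)) (b : R -> 'cV[R]_m) : set (R -> 'cV[R]_n) :=
  [set z | Linfty_mx T z /\
     {ae @mu R, forall t, t \in `[0, T] ->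
        forall i, (A t *m z t) i 0 <= b t i 0}].

Definition objective (R : realType) (T : R) (n : nat) (c z : R -> 'cV[R]_n)
    : R :=
  \int[@mu R]_(t in `[0, T]) (((c t)^T *m z t) 0 0).

Definition optimal_solution (R : realType) (T : R) (m n : nat)
    (A : R -> 'M[R]_(m, n)) (b : R -> 'cV[R]_m) (c : R -> 'cV[R]_n)
    (zbar : R -> 'cV[R]_n) : Prop :=
  feasible T A b zbar /\
  forall z, feasible T A b z -> objective T c zbar <= objective T c z.

(* Main.v *)
(* The objective is linear and the feasible set C is convex, bounded and closed
   under a.e. limits, so a minimizer is found without weak-* compactness, by the
   minimal-norm argument in L^2.  With C_r the set of r-minimizers of F over C
   and G the squared L^2 norm, let d be the supremum over r > 0 of inf_(C_r) G.
   Choose u_k in C_(r_k) with r_k -> 0, inf_(C_(r_k)) G > d - 4^-k and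
   G(u_k) < d + 4^-k.  Midpoints of r-minimizers are r-minimizers, so the
   parallelogram law makes |u_(k+1) - u_k|^2 of order 4^-k; hence u_k converges
   a.e., its limit is feasible, and dominated convergence shows that the limit
   is optimal. *)
Require Import Defs.
From mathcomp Require Import all_boot all_order all_algebra.
From mathcomp Require Import all_classical all_reals all_analysis.
From mathcomp Require Import measurable_realfun ess_sup_inf ring lra.
Set Implicit Arguments.
Unset Strict Implicit.
Unset Printing Implicit Defensive.
Import Order.TTheory GRing.Theory Num.Theory.
Import numFieldNormedType.Exports.
Local Open Scope classical_set_scope.
Local Open Scope ring_scope.

(** * Almost-minimizing sequences over an abstract set with midpoints *)

(** Near-minimality for [F] is stable under [mid], so the midpoint of two terms cannot bring [G] far
    below the level that both nearly attain. The last bound is a midpoint-convexity defect of [G];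
    the parallelogram law later turns it into a squared distance. *)
Lemma almost_minimizing_sequence (R : realType) (V : Type) (mid : V -> V -> V)
    (C : set V) (F G : V -> R) (L K : R) (e : nat -> R) :
  C !=set0 ->
  (forall z w, C z -> C w -> C (mid z w)) ->
  (forall z w, C z -> C w -> F (mid z w) <= Num.max (F z) (F w)) ->
  (forall z, C z -> L <= F z) -> (forall z, C z -> 0 <= G z <= K) ->
  (forall k, 0 < e k) -> (forall k, e k.+1 <= e k) ->
  exists u : nat -> V, forall k, [/\ C (u k),
    forall w, C w -> F (u k) <= F w + e k &
    G (u k) + G (u k.+1) - 2 * G (mid (u k) (u k.+1)) <= 4 * e k].
Proof.
move=> [z0 Cz0] Cmid Fmid FL GK e_gt0 e_dec.
pose amin r := [set z | C z /\ forall w, C w -> F z <= F w + r].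
have amin_mid r z w : amin r z -> amin r w -> amin r (mid z w).
  move=> [Cz zr] [Cw wr]; split; first exact: Cmid.
  move=> v Cv; apply: le_trans (Fmid _ _ Cz Cw) _.
  by rewrite ge_max zr ?wr.
have amin_le r s z : r <= s -> amin r z -> amin s z.
  by move=> rs [Cz zr]; split=> // w /zr h; apply: le_trans h _; rewrite lerD2l.
have aminN0 r : 0 < r -> amin r !=set0.
  move=> r0; have infF : has_inf (F @` C).
    by split; [exists (F z0), z0|exists L => _ [z Cz <-]; exact: FL].
  have [_ [z Cz <-] zr] := inf_adherent r0 infF.
  exists z; split=> // w Cw; apply/ltW/(lt_le_trans zr); rewrite lerD2r.
  by apply: ge_inf; [exact: infF.2|exists w].
(* [S] collects the lower bounds of [G] over the sets [amin r], so [sup S] is the number d, a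
   supremum of infima, without any infimum being named. *)
pose S := [set s | exists2 r, 0 < r & forall z, amin r z -> s <= G z].
have supS : has_sup S.
  split; first by exists 0, 1 => // z [/GK/andP[]].
  exists K => s [r r0 sG]; have [z zr] := aminN0 _ r0.
  by apply: le_trans (sG _ zr) _; have [/GK/andP[]] := zr.
have step k : exists zr : V * R, [/\ 0 < zr.2 <= e k, amin zr.2 zr.1,
    G zr.1 < sup S + e k & forall z, amin zr.2 z -> sup S - e k <= G z].
  have [s [r r0 sG] ds] := sup_adherent (e_gt0 k) supS.
  (* Shrinking [r] keeps the lower bound on [G], since [amin r'] is contained in [amin r], and
     forces [r' <= e k]. *)
  pose r' := Num.min r (e k).
  have r'0 : 0 < r' by rewrite lt_min r0 e_gt0.
  have [z zr' Gz] : exists2 z, amin r' z & G z < sup S + e k.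
    (* Otherwise [sup S + e k] would itself belong to [S], with radius [r']. *)
    apply: contrapT => noz; have : S (sup S + e k).
      exists r' => // z zr'; rewrite leNgt; apply/negP => Gz; apply: noz.
      by exists z.
    move/(sup_upper_bound supS); have := e_gt0 k; lra.
  exists (z, r'); split=> //=; first by rewrite r'0 ge_min lexx orbT.
  move=> w wr'; apply: le_trans (ltW ds) _; apply: sG.
  by apply: amin_le wr'; rewrite ge_min lexx.
have [ur urP] := choice step.
exists (fun k => (ur k).1) => k.
have [/andP[_ rke] [Cuk uk_min] Guk Gk] := urP k.
have [/andP[_ rSe] _ GuS GS] := urP k.+1.
split=> // [w Cw|].
  by apply: le_trans (uk_min _ Cw) _; rewrite lerD2l.
(* Both values of [G] lie below [sup S + e k], so the defect is at most 2 [e k] + 2 [e k]. *)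
suff : sup S - e k <= G (mid (ur k).1 (ur k.+1).1).
  by have := e_dec k; lra.
have [_ ak _ _] := urP k; have [_ aS _ _] := urP k.+1.
(* The radii need not decrease with [k]: the midpoint lies in [amin] of the larger radius, and the
   lower bound chosen at that index applies. *)
have [rr|/ltW rr] := leP (ur k).2 (ur k.+1).2.
  apply: le_trans (GS _ _); first by have := e_dec k; lra.
  by apply: amin_mid => //; apply: amin_le ak.
by apply/Gk/amin_mid => //; apply: amin_le aS.
Qed.

(** * Almost-everywhere convergence from small L^2 increments *)

(** A series of nonnegative majorants of the increments has finite integral, hence is finite a.e.;
    at such points the telescoping series converges absolutely. *)
Lemma ae_cvg_sqr_increments d (X : measurableType d) (R : realType)
    (mu : {measure set X -> \bar R}) (D : set X) (u : nat -> X -> R) (K : R) :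
  measurable D -> (mu D < +oo)%E -> (forall k, measurable_fun D (u k)) ->
  (forall k, \int[mu]_(t in D) ((u k.+1 t - u k t) ^+ 2)%:E
             <= (K / 4 ^+ k)%:E)%E ->
  {ae mu, forall t, D t -> cvgn (u ^~ t)}.
Proof.
move=> mD muD mu_ uK.
have muDE : mu D = (fine (mu D))%:E by rewrite fineK// ge0_fin_numE.
have K0 : 0 <= K.
  rewrite -lee_fin (_ : K = K / 4 ^+ 0); last by rewrite expr0 divr1.
  apply: le_trans (uK 0%N); apply: integral_ge0 => t _.
  by rewrite lee_fin sqr_ge0.
(* [|x| <= 2^-k + 2^k x^2] makes the increments summable in L1. *)
pose h k t := ((2 ^+ k)^-1 + 2 ^+ k * (u k.+1 t - u k t) ^+ 2)%:E.
have msq k : measurable_fun D (fun t => (u k.+1 t - u k t) ^+ 2).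
  exact/measurable_funX/measurable_funB.
have h0 k t : (0 <= h k t)%E.
  have a0 : 0 <= 2 ^+ k :> R by exact: exprn_ge0.
  by rewrite lee_fin addr_ge0 ?invr_ge0// mulr_ge0// sqr_ge0.
have mh k : measurable_fun D (h k).
  apply/measurable_EFinP/measurable_funD; first exact: measurable_cst.
  exact: measurable_funM (measurable_cst _) (msq k).
(* The bound is 2^-k (mu D + K), written over 2^(k+1) to fit [epsilon_trick0], which sums such terms
   to at most the numerator. *)
have inth k : (\int[mu]_(t in D) h k t
    <= ((2 * (fine (mu D) + K)) / (2 ^ k.+1)%:R)%:E)%E.
  rewrite /h; under eq_integral do rewrite EFinD EFinM.
  rewrite ge0_integralD//; last 2 first.
  - by move=> t _; rewrite -EFinM lee_fin mulr_ge0 ?sqr_ge0// exprn_ge0.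
  - apply/measurable_EFinP.
    exact: measurable_funM (measurable_cst _) (msq k).
  rewrite ge0_integralZl_EFin//; last 2 first.
  - by move=> t _; rewrite lee_fin sqr_ge0.
  - exact/measurable_EFinP.
  rewrite (integral_cst mu mD) muDE -EFinM.
  apply: (@le_trans _ _
    ((2 ^+ k)^-1 * fine (mu D) + 2 ^+ k * (K / 4 ^+ k))%:E)%E.
    rewrite EFinD; apply: leeD => //; rewrite [leRHS]EFinM.
    by apply: lee_wpmul2l; rewrite ?lee_fin ?exprn_ge0.
  rewrite lee_fin natrX exprS (_ : 4 = 2 * 2); last by ring.
  rewrite exprMn le_eqVlt; apply/orP; left; apply/eqP; field.
  by rewrite expf_neq0.
have ih : mu.-integrable D (fun t => \sum_(k <oo) h k t)%E.
  apply/integrableP; split; first exact: ge0_emeasurable_sum.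
  under eq_integral do rewrite gee0_abs ?nneseries_ge0//.
  rewrite integral_nneseries//.
  apply: le_lt_trans (ltry (2 * (fine (mu D) + K))).
  apply: le_trans (epsilon_trick0 xpredT _); last first.
    by rewrite mulr_ge0// addr_ge0// fine_ge0.
  by apply: lee_nneseries => k _ //; rewrite integral_ge0.
apply: filterS (integrable_ae mD ih) => t ht Dt; have {}ht := ht Dt.
have : cvgn (series (telescope (u ^~ t))).
  apply: normed_cvg; apply: nondecreasing_is_cvgn.
    by apply: nondecreasing_series => k _ _; exact: normr_ge0.
  exists (fine (\sum_(k <oo) h k t)%E) => _ [k _ <-].
  rewrite -lee_fin fineK//.
  apply: le_trans (nneseries_lim_ge k (fun i _ _ => h0 i t)).
  rewrite /series/= -sumEFin; apply: lee_sum => i _.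
  rewrite lee_fin /telescope; set x := u i.+1 t - u i t; set a := 2 ^+ i.
  have a0 : 0 < a by rewrite exprn_gt0.
  have aV : a * a^-1 = 1 by rewrite divff ?gt_eqF.
  have aV0 : 0 < a^-1 by rewrite invr_gt0.
  (* After multiplication by [a], the claim reads y <= 1 + y^2 with y = a |x|. *)
  rewrite -(ler_pM2l a0) mulrDr aV -(real_normK (num_real x)).
  rewrite mulrA -expr2 -exprMn; set y := a * `|x|.
  by have := sqr_ge0 (y - 1); have := sqr_ge0 y; nra.
move=> cvgt.
rewrite (_ : u ^~ t = cst (u 0%N t) \+ series (telescope (u ^~ t))).
  by apply: is_cvgD cvgt; exact: is_cvg_cst.
by apply/funext => k; rewrite /= [LHS](eq_sum_telescope (u ^~ t)).
Qed.

(** * Calculus of essentially bounded functions *)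

(** L^infty on [D] through an explicit a.e. bound, which adds and multiplies along sums and
    products; [LinftyP] matches it with the norm-based definition. *)
Definition ess_bounded d (X : measurableType d) (R : realType)
    (mu : {measure set X -> \bar R}) (D : set X) (f : X -> R) : Prop :=
  measurable_fun D f /\ exists M, {ae mu, forall t, D t -> `|f t| <= M}.

Lemma ess_boundedD d (X : measurableType d) (R : realType)
    (mu : {measure set X -> \bar R}) (D : set X) (f g : X -> R) :
  ess_bounded mu D f -> ess_bounded mu D g ->
  ess_bounded mu D (fun t => f t + g t).
Proof.
move=> [mf [M fM]] [mg [N gN]]; split; first exact: measurable_funD.
exists (M + N); apply: filterS2 fM gN => t fM gN Dt.
by apply: le_trans (ler_normD _ _) _; rewrite lerD ?fM ?gN.
Qed.

Lemma ess_boundedM d (X : measurableType d) (R : realType)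
    (mu : {measure set X -> \bar R}) (D : set X) (f g : X -> R) :
  ess_bounded mu D f -> ess_bounded mu D g ->
  ess_bounded mu D (fun t => f t * g t).
Proof.
move=> [mf [M fM]] [mg [N gN]]; split; first exact: measurable_funM.
exists (M * N); apply: filterS2 fM gN => t fM gN Dt.
by rewrite normrM ler_pM ?fM ?gN.
Qed.

Lemma ess_bounded_sum d (X : measurableType d) (R : realType)
    (mu : {measure set X -> \bar R}) (D : set X) (I : Type) (s : seq I)
    (f : I -> X -> R) :
  (forall i, ess_bounded mu D (f i)) ->
  ess_bounded mu D (fun t => \sum_(i <- s) f i t).
Proof.
move=> bf; elim: s => [|i s IHs].
  under eq_fun do rewrite big_nil; split; first exact: measurable_cst.
  by exists 0; apply: nearW => t _; rewrite normr0.
by under eq_fun do rewrite big_cons; exact: ess_boundedD.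
Qed.

Lemma ess_bounded_integrable d (X : measurableType d) (R : realType)
    (mu : {measure set X -> \bar R}) (D : set X) (f : X -> R) :
  measurable D -> (mu D < +oo)%E -> ess_bounded mu D f ->
  mu.-integrable D (EFin \o f).
Proof.
move=> mD muD [mf [M fM]].
apply/integrableP; split; first exact/measurable_EFinP.
(* [M] may be negative when [D] is null, hence the absolute value. *)
apply: le_lt_trans (integral_le_bound `|M|%:E mD _ _ _) _.
- exact/measurable_EFinP.
- by rewrite lee_fin.
- apply: filterS fM => t fM /fM ftM; rewrite lee_fin.
  exact: le_trans ftM (ler_norm M).
- by rewrite lte_mul_pinfty ?lee_fin.
Qed.

Lemma normr_Rintegral_le d (X : measurableType d) (R : realType)
    (mu : {measure set X -> \bar R}) (D : set X) (f : X -> R) (M : R) :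
  measurable D -> (mu D < +oo)%E -> 0 <= M -> measurable_fun D f ->
  {ae mu, forall t, D t -> `|f t| <= M} ->
  `|\int[mu]_(t in D) f t| <= M * fine (mu D).
Proof.
move=> mD muD M0 mf fM.
have intf : mu.-integrable D (EFin \o f).
  by apply: ess_bounded_integrable => //; split=> //; exists M.
rewrite -lee_fin EFin_normr_Rintegral// EFinM fineK ?ge0_fin_numE//.
have mEf : measurable_fun D (EFin \o f) by exact/measurable_EFinP.
by apply: le_trans (le_abse_integral mu mD mEf) _; exact: integral_le_bound.
Qed.

Lemma cvg_mulmx_coord (R : realType) (m n : nat) (A : 'M[R]_(m, n))
    (z_ : nat -> 'cV[R]_n) (z : 'cV[R]_n) (i : 'I_m) :
  (forall j, z_ k j 0 @[k --> \oo] --> z j 0) ->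
  (A *m z_ k) i 0 @[k --> \oo] --> (A *m z) i 0.
Proof.
move=> zj; rewrite mxE; under eq_fun do rewrite mxE.
apply: cvg_big => [|j _]; first exact: add_continuous.
by apply: cvgM; [exact: cvg_cst|exact: zj].
Qed.

Lemma ess_bounded_cst d (X : measurableType d) (R : realType)
    (mu : {measure set X -> \bar R}) (D : set X) (a : R) :
  ess_bounded mu D (cst a).
Proof.
by split; [exact: measurable_cst|exists `|a|; apply: nearW => t _ /=].
Qed.

(** * Minimizing a linear integral functional over a convex set *)

(** Almost-minimizers with small [G]-defect converge a.e., and the uniform bound [M] lets the
    integral pass to the limit. Convexity and closedness enter only through midpoints and a.e.
    limits, the two properties to be checked for the linear constraints. *)
Lemma ess_bounded_convex_argmin d (X : measurableType d) (R : realType)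
    (mu : {measure set X -> \bar R}) (D : set X) (n : nat)
    (c : X -> 'cV[R]_n) (C : set (X -> 'cV[R]_n)) (M : R) :
  measurable D -> (mu D < +oo)%E ->
  (forall i, ess_bounded mu D (fun t => c t i 0)) ->
  C !=set0 ->
  (forall z, C z -> forall i, measurable_fun D (fun t => z t i 0)) ->
  (forall z, C z -> {ae mu, forall t, D t -> forall i, `|z t i 0| <= M}) ->
  (forall z w, C z -> C w -> C (fun t => 2^-1 *: (z t + w t))) ->
  (forall (z_ : nat -> X -> 'cV[R]_n) (z : X -> 'cV[R]_n),
     (forall k, C (z_ k)) ->
     (forall i, measurable_fun D (fun t => z t i 0)) ->
     {ae mu, forall t, D t -> forall i, z_ k t i 0 @[k --> \oo] --> z t i 0} ->
     C z) ->
  exists2 z, C z & forall w, C w ->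
    \int[mu]_(t in D) ((c t)^T *m z t) 0 0 <=
    \int[mu]_(t in D) ((c t)^T *m w t) 0 0.
Proof.
move=> mD muD bc CN0 mC CM Cmid Ccl.
pose f (z : X -> 'cV[R]_n) t := ((c t)^T *m z t) 0 0.
pose g (z : X -> 'cV[R]_n) t := \sum_i z t i 0 * z t i 0.
have fE z t : f z t = \sum_i c t i 0 * z t i 0.
  by rewrite /f mxE; apply: eq_bigr => i _; rewrite mxE.
have bz z i : C z -> ess_bounded mu D (fun t => z t i 0).
  move=> Cz; split; first exact: mC.
  by exists M; apply: filterS (CM _ Cz) => t zM /zM.
have bf z : C z -> ess_bounded mu D (f z).
  move=> Cz; rewrite (_ : f z = fun t => \sum_i c t i 0 * z t i 0); last first.
    exact/funext/fE.
  by apply: ess_bounded_sum => i; apply: ess_boundedM => //; exact: bz.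
have bg z : C z -> ess_bounded mu D (g z).
  by move=> Cz; apply: ess_bounded_sum => i; apply: ess_boundedM; exact: bz.
have intf z : C z -> mu.-integrable D (EFin \o f z).
  by move=> /bf; exact: ess_bounded_integrable.
have intg z : C z -> mu.-integrable D (EFin \o g z).
  by move=> /bg; exact: ess_bounded_integrable.
pose F z := \int[mu]_(t in D) f z t.
pose G z := \int[mu]_(t in D) g z t.
(* One [B] for all of [C]: it bounds [F] from below here and is the dominating constant at the
   end. *)
have [B B0 fB] : exists2 B, 0 <= B &
    forall z, C z -> {ae mu, forall t, D t -> `|f z t| <= B}.
  have [Mc cM] := choice (fun i => (bc i).2).
  exists (\sum_i `|Mc i| * `|M|).
    by apply: sumr_ge0 => i _; rewrite mulr_ge0.
  move=> z Cz; have /= cM' := filter_forall (ae_filter_ringOfSetsType mu) cM.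
  apply: filterS2 cM' (CM _ Cz) => t cMt zMt Dt; rewrite fE.
  apply: le_trans (ler_norm_sum _ _ _) _; apply: ler_sum => i _.
  rewrite normrM ler_pM//.
    exact: le_trans (cMt i Dt) (ler_norm _).
  exact: le_trans (zMt Dt i) (ler_norm _).
have FL z : C z -> - (B * fine (mu D)) <= F z.
  move=> Cz; have := normr_Rintegral_le mD muD B0 (bf _ Cz).1 (fB _ Cz).
  by rewrite ler_norml => /andP[].
have GK z : C z -> 0 <= G z <= (\sum_(i < n) M * M) * fine (mu D).
  move=> Cz; apply/andP; split.
    apply: Rintegral_ge0 => t _; apply: sumr_ge0 => i _.
    by rewrite -expr2 sqr_ge0.
  have M20 : 0 <= \sum_(i < n) M * M.
    by apply: sumr_ge0 => i _; rewrite -expr2 sqr_ge0.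
  apply: le_trans (ler_norm _) _.
  apply: normr_Rintegral_le => //; first exact: (bg _ Cz).1.
  apply: filterS (CM _ Cz) => t zM Dt; apply: le_trans (ler_norm_sum _ _ _) _.
  by apply: ler_sum => i _; rewrite normrM ler_pM ?zM.
pose mid (z w : X -> 'cV[R]_n) t := 2^-1 *: (z t + w t).
have Fmid z w : C z -> C w -> F (mid z w) <= Num.max (F z) (F w).
  move=> Cz Cw; have -> : F (mid z w) = 2^-1 * (F z + F w).
    rewrite -RintegralD ?intf// -RintegralZl//; last first.
      by apply: ess_bounded_integrable => //; apply: ess_boundedD; exact: bf.
    apply: eq_Rintegral => t _.
    by rewrite /f /mid -scalemxAr mulmxDr !mxE.
  by rewrite le_max; case: (leP (F z) (F w)) => h; apply/orP; [right|left]; lra.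
pose sqdist (z w : X -> 'cV[R]_n) t := \sum_i (z t i 0 - w t i 0) ^+ 2.
have bsqdist z w : C z -> C w -> ess_bounded mu D (sqdist z w).
  move=> Cz Cw.
  have bN : ess_bounded mu D (cst (-1)) by exact: ess_bounded_cst.
  apply: ess_bounded_sum => i.
  have bzw : ess_bounded mu D (fun t => z t i 0 - w t i 0).
    under eq_fun do rewrite -mulN1r.
    by apply: ess_boundedD; [exact: bz|exact: ess_boundedM bN (bz _ i Cw)].
  exact: (ess_boundedM bzw bzw).
have Gmid z w : C z -> C w ->
    \int[mu]_(t in D) sqdist z w t = 2 * (G z + G w - 2 * G (mid z w)).
  move=> Cz Cw; have Cm := Cmid _ _ Cz Cw.
  have b4 : ess_bounded mu D (cst (4 : R)) by exact: ess_bounded_cst.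
  (* The parallelogram law, arranged without subtraction so that additivity and scaling of the
     integral reduce it to a pointwise identity in each coordinate. *)
  suff : \int[mu]_(t in D) sqdist z w t + 4 * G (mid z w) =
    2 * (G z + G w) by lra.
  rewrite -RintegralD ?intg// -!RintegralZl ?intg// -?RintegralD//; last 3 first.
  - by apply: ess_bounded_integrable => //; exact: bsqdist.
  - apply: ess_bounded_integrable => //.
    by apply: ess_boundedM b4 _; exact: bg.
  - apply: ess_bounded_integrable => //.
    by apply: ess_boundedD; exact: bg.
  apply: eq_Rintegral => t _.
  rewrite /sqdist /g !mulr_sumr -!big_split/= mulr_sumr.
  by apply: eq_bigr => i _; rewrite /mid !mxE; field.
have e_gt0 k : 0 < (4 ^+ k)^-1 :> R by rewrite invr_gt0 exprn_gt0.
have e_dec k : (4 ^+ k.+1)^-1 <= (4 ^+ k)^-1 :> R.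
  by rewrite lef_pV2 ?posrE ?exprn_gt0// ler_eXn2l ?ltr1n.
have [u uP] := almost_minimizing_sequence CN0 Cmid Fmid FL GK e_gt0 e_dec.
have Cu k : C (u k) by have [] := uP k.
have u_cvg i : {ae mu, forall t, D t -> cvgn (fun k => u k t i 0)}.
  (* The constant 8 is the factor 2 of [Gmid] times the 4 in the defect bound, with [e k] = 4^-k. *)
  apply: (@ae_cvg_sqr_increments _ _ _ _ _ (fun k t => u k t i 0) 8) => // [k|k].
    exact: mC.
  have bd := bsqdist _ _ (Cu k.+1) (Cu k).
  apply: (@le_trans _ _ (\int[mu]_(t in D) (sqdist (u k.+1) (u k) t)%:E)%E).
    apply: ge0_le_integral => //.
    - by move=> t _; rewrite lee_fin sqr_ge0.
    - apply/measurable_EFinP; apply: measurable_funX.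
      exact: (measurable_funB (mC _ (Cu k.+1) i) (mC _ (Cu k) i)).
    - by apply/measurable_EFinP; exact: bd.1.
    - move=> t _; rewrite lee_fin /sqdist (bigD1 i)//= lerDl.
      by apply: sumr_ge0 => j _; rewrite sqr_ge0.
  rewrite -[leLHS]fineK; last first.
    apply: integrable_fin_num => //.
    exact: ess_bounded_integrable bd.
  have [_ _ uk] := uP k; rewrite lee_fin.
  rewrite [leLHS](Gmid _ _ (Cu k.+1) (Cu k)).
  have -> : mid (u k.+1) (u k) = mid (u k) (u k.+1).
    by apply/funext => t; rewrite /mid addrC.
  by rewrite -/(mid (u k) (u k.+1)) in uk; lra.
have u_cvg' : {ae mu, forall t, D t -> forall i, cvgn (fun k => u k t i 0)}.
  have /= := filter_forall (ae_filter_ringOfSetsType mu) u_cvg.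
  by apply: filterS => t ut Dt i; exact: ut.
have [N [mN N0 uN]] := u_cvg'.
(* Setting the sequence to 0 on the null set [N] makes it converge at every point of [D], so that
   its limit is measurable. *)
pose v i k := (fun t => u k t i 0) \_ (~` N).
have v_cvg i t : D t -> cvgn (v i ^~ t).
  move=> Dt; rewrite /v /patch; have [|_] := boolP (t \in ~` N); last first.
    exact: is_cvg_cst.
  rewrite inE => Nt; apply: contrapT => ut; apply: Nt; apply: uN => /=.
  by move=> /(_ Dt i).
pose z t : 'cV[R]_n := \col_i limn (v i ^~ t).
have uz : {ae mu, forall t, D t ->
    forall i, u k t i 0 @[k --> \oo] --> z t i 0}.
  exists N; split=> // t /= /not_implyP[Dt /existsNP[i nut]].
  apply: contrapT => Nt; apply: nut.
  have := v_cvg i t Dt; rewrite /z mxE.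
  by rewrite /v /patch mem_set.
have mz i : measurable_fun D (fun t => z t i 0).
  apply: (@measurable_fun_cvg _ _ _ _ (v i)) => [k|t Dt]; last first.
    by rewrite mxE; exact: v_cvg.
  apply/measurable_restrict => //; first exact: measurableC.
  by apply: measurable_funS (mC _ (Cu k) i) => //; exact: subIsetl.
have Cz : C z by exact: Ccl uz.
exists z => // w Cw; rewrite -/(F z) -/(F w).
have Fu : F (u k) @[k --> \oo] --> F z.
  apply: fine_cvg; rewrite fineK; last first.
    by apply: integrable_fin_num => //; exact: intf.
  have mEf x : C x -> measurable_fun D (fun t => (f x t)%:E).
    by move=> Cx; apply/measurable_EFinP; exact: (bf _ Cx).1.
  have uzE : {ae mu, forall t, D t ->
      (f (u k) t)%:E @[k --> \oo] --> (f z t)%:E}.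
    apply: filterS uz => t uzt Dt; apply/cvg_EFin; first by near=> k.
    by apply: cvg_mulmx_coord => i; exact: uzt.
  have iB : mu.-integrable D (EFin \o cst B).
    by apply: ess_bounded_integrable => //; exact: ess_bounded_cst.
  have fuB : {ae mu, forall t k, D t -> (`|(f (u k) t)%:E| <= B%:E)%E}.
    apply: ae_foralln => k; apply: filterS (fB _ (Cu k)) => t fut Dt.
    by rewrite lee_fin fut.
  by have [] := dominated_convergence mD (fun k => mEf _ (Cu k)) (mEf _ Cz)
    uzE iB fuB.
have Fe : F w + (4 ^+ k)^-1 @[k --> \oo] --> F w.
  rewrite -[X in _ --> X]addr0; apply: cvgD; first exact: cvg_cst.
  rewrite (_ : (fun k => _) = geometric 1 4^-1); first apply: cvg_geometric.
    by rewrite gtr0_norm ?invf_lt1 ?ltr1n.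
  by apply/funext => k; rewrite /= mul1r exprVn.
apply: ler_cvg_to Fu Fe _; apply: nearW => k.
by have [_ /(_ w Cw)] := uP k.
Unshelve. all: by end_near. Qed.

(** * Transfer to completed Lebesgue measure on [[0, T]] *)

Local Notation mu := completed_lebesgue_measure.

#[local] Instance ae_completed_lebesgue_filter (R : realType) :
  Filter (nbhs (almost_everywhere (@mu R))).
Proof. exact: ae_filter_ringOfSetsType (@mu R : {measure set _ -> \bar R}). Qed.

Lemma completed_lebesgue_measurable_itv (R : realType) (a b : R) :
  measurable
    (`[a, b]%classic : set (caratheodory_type (wlength (@idfun R))^*%mu)).
Proof. by apply: sub_caratheodory; exact: measurable_itv. Qed.

Lemma completed_lebesgue_itv (R : realType) (T : R) : 0 < T ->
  @mu R `[0, T] = T%:E.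
Proof.
move=> T0; rewrite -[LHS]/(@lebesgue_measure R `[0, T]) lebesgue_measure_itv/=.
by rewrite lte_fin T0 sube0.
Qed.

Lemma Lnorm_completed_lebesgue_le (R : realType) (f : R -> R) (M : \bar R) :
  ('N[@mu R]_+oo [EFin \o f] <= M)%E <->
  {ae @mu R, forall t, (`|f t|%:E <= M)%E}.
Proof.
(* The norm of exponent [+oo] is the essential supremum only when the whole space has positive
   measure. *)
have mu0 : (0 < @mu R setT)%E.
  apply: (@lt_le_trans _ _ (@mu R `[0, 1])).
    by rewrite completed_lebesgue_itv// lte_fin.
  apply: le_measure; rewrite ?inE//.
  exact: completed_lebesgue_measurable_itv.
by rewrite unlock mu0; split=> [/ess_supP|?]; last exact/ess_supP.
Qed.

Lemma LinftyP (R : realType) (T : R) (f : R -> R) :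
  Linfty T f <-> ess_bounded (@mu R) `[0, T] f.
Proof.
have mD := completed_lebesgue_measurable_itv 0 T.
rewrite /Linfty; split=> [/andP[]|[mf [M fM]]]; last apply/andP; rewrite !inE/=.
  rewrite /finite_norm => mf fN; split; first exact/(measurable_restrictT _ mD).
  (* The finite norm itself serves as the a.e. bound. *)
  have [/(_ (lexx _)) fle _] := Lnorm_completed_lebesgue_le (f \_ `[0, T])
    ('N[@mu R]_+oo [EFin \o f \_ `[0, T]]).
  exists (fine ('N[@mu R]_+oo [EFin \o f \_ `[0, T]])).
  apply: filterS fle => t ft Dt.
  rewrite -lee_fin fineK ?ge0_fin_numE ?Lnorm_ge0//.
  by apply: le_trans ft; rewrite /patch mem_set.
split; first exact/(measurable_restrictT _ mD).
(* The extension by 0 must also obey the bound outside [[0, T]], so the bound has to be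
   nonnegative. *)
apply: le_lt_trans (ltry `|M|); apply/Lnorm_completed_lebesgue_le.
apply: filterS fM => t fM; rewrite lee_fin /patch.
case: ifPn => [|_]; last by rewrite normr0.
by rewrite inE => /fM ftM; exact: le_trans ftM (ler_norm M).
Qed.

Lemma ler_mx_norm_coord (R : realDomainType) (m n : nat) (x : 'M[R]_(m, n))
    (i : 'I_m) (j : 'I_n) : `|x i j| <= `|x|.
Proof.
rewrite [leRHS]mx_normrE.
exact: (le_bigmax _ (fun ij => `|x ij.1 ij.2|) (i, j)).
Qed.

(** The maximum norm dominates each coordinate. This turns boundedness of the feasible set into the
    uniform bound [M], with a null set that depends on [z]. *)
Lemma ae_le_Linfty_norm (R : realType) (T : R) (n : nat) (z : R -> 'cV[R]_n)
    (M : R) :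
  (Linfty_norm T z <= M%:E)%E ->
  {ae @mu R, forall t, `[0, T]%classic t -> forall i, `|z t i 0| <= M}.
Proof.
move=> /Lnorm_completed_lebesgue_le; apply: filterS => t zt Dt i.
move: zt; rewrite /patch mem_set// lee_fin normr_id; apply: le_trans.
exact: ler_mx_norm_coord.
Qed.

(** * Existence of an optimal solution of (CLP) *)

Theorem proposition2p7 (R : realType) (T : R) (m n : nat)
    (A : R -> 'M[R]_(m, n)) (b : R -> 'cV[R]_m) (c : R -> 'cV[R]_n) :
  0 < T ->
  Linfty_mx T A -> Linfty_mx T b -> Linfty_mx T c ->
  feasible T A b !=set0 ->
  Linfty_bounded T (feasible T A b) ->
  exists zbar : R -> 'cV[R]_n, optimal_solution T A b c zbar.
Proof.
move=> T0 _ _ bc feasN0 [M feasM].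
have mD := completed_lebesgue_measurable_itv 0 T.
have muD : (@mu R `[0%R, T] < +oo)%E by rewrite completed_lebesgue_itv// ltry.
have zM z : feasible T A b z ->
    {ae @mu R, forall t, `[0, T]%classic t -> forall i, `|z t i 0| <= M}.
  by move=> /feasM /ae_le_Linfty_norm.
suff [z fz zmin] : exists2 z, feasible T A b z &
    forall w, feasible T A b w -> objective T c z <= objective T c w.
  by exists z; split.
apply: (@ess_bounded_convex_argmin _ _ R (@mu R) `[0, T] n c
  (feasible T A b) M) => //.
- by move=> i; apply/LinftyP; exact: bc.
- by move=> z [bz _] i; have /LinftyP[] := bz i 0.
- move=> z w [bz zb] [bw wb]; split.
    move=> i j; apply/LinftyP.
    have -> : (fun t => (2^-1 *: (z t + w t)) i j) =
        fun t => 2^-1 * (z t i j + w t i j) by apply/funext => t; rewrite !mxE.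
    apply: ess_boundedM; first exact: ess_bounded_cst.
    by apply: ess_boundedD; exact/LinftyP.
  (* The constraint at the midpoint is the average of the constraints at [z] and [w]. *)
  apply: filterS2 zb wb => t zb wb Dt i.
  rewrite -scalemxAr mulmxDr !mxE.
  have := zb Dt i; have := wb Dt i; rewrite !mxE; lra.
- move=> z_ z fz_ mz z_z.
  (* The null sets for the separate [k] form a countable family, so outside a single null set the
     bounds hold for all [k] and pass to the limit. *)
  have z_zM : {ae @mu R, forall t, t \in `[0, T] ->
      forall k i, `|z_ k t i 0| <= M}.
    have /ae_foralln := fun k => zM _ (fz_ k).
    by apply: filterS => t ztM Dt k; exact: ztM.
  split.
    (* The limit inherits the bound [M], which puts it back in L^infty. *)
    move=> i j; rewrite (ord1 j); apply/LinftyP; split; first exact: mz.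
    exists M; apply: filterS2 z_z z_zM => t zt ztM Dt.
    apply: (ler_cvg_to (cvg_norm (zt Dt i)) (cvg_cst M)).
    by apply: nearW => k; exact: ztM.
  have /ae_foralln z_b := fun k => (fz_ k).2.
  apply: filterS2 z_z z_b => t zt ztb Dt i.
  apply: (ler_cvg_to (cvg_mulmx_coord (zt Dt)) (cvg_cst (b t i 0))).
  by apply: nearW => k; exact: ztb.
Qed.
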